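(* Let $\mathcal T_1=(S_1,\Sigma_1,\kappa_1)$ be a stochastic transition system and $\mathcal T_2=(S_2,2^{S_2},\kappa_2)$ a finite Markov chain which is an $\alpha$-abstraction of $\mathcal T_1$, for a measurable $\alpha:S_1\to S_2$. Fix $\mu\in\mathrm{Dist}(S_1)$ and assume that $\mathcal T_1$ is fair from $\mu$ w.r.t. every $\alpha$-closed set. Then $\mathcal T_1$ is decisive from $\mu$ w.r.t. every $\alpha$-closed set.
   Context: A stochastic transition system (STS) is $\mathcal T=(S,\Sigma,\kappa)$ where $(S,\Sigma)$ is a measurable space and $\kappa:S\times\Sigma\to[0,1]$ is a Markov kernel. It is a finite Markov chain if $S$ is finite and $\Sigma=2^S$. $\mathrm{Dist}(S)$ is the set of probability measures on $(S,\Sigma)$; $\mathrm{Dist}(B)$ those with $\mu(B)=1$; $\delta_s$ is the Dirac measure. For $\mu\in\mathrm{Dist}(S)$, $\mathrm{Prob}^{\mathcal T}_\mu$ is the law on infinite paths $s_0s_1\dots\in S^\omega$ (cylinder $\sigma$-algebra) of the Markov chain with initial distribution $\mu$ and kernel $\kappa$. Events: $\mathbf F B$: $\exists i\ge0,\ s_i\in B$; $\mathbf G\mathbf F B$: $s_i\in B$ for infinitely many $i$. Avoid-set: $\widetilde B=\{s\in S\mid\mathrm{Prob}^{\mathcal T}_{\delta_s}(\mathbf F B)=0\}$ (measurable). $\mathcal T$ is decisive from $\mu$ w.r.t. $B\in\Sigma$ if $\mathrm{Prob}^{\mathcal T}_\mu(\mathbf F B\vee\mathbf F\widetilde B)=1$.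 $\mathcal T$ is fair from $\mu$ w.r.t. $B\in\Sigma$ if for every $B'\in\Sigma$ such that $\mathrm{Prob}^{\mathcal T}_{\mu'}(s_0\in B',s_1\in B)>0$ for all $\mu'\in\mathrm{Dist}(B')$: $\mathrm{Prob}^{\mathcal T}_\mu(\mathbf G\mathbf F B')>0$ implies $\mathrm{Prob}^{\mathcal T}_\mu(\mathbf G\mathbf F B\mid\mathbf G\mathbf F B')=1$. $\Omega_{\mathcal T}(\mu)(A)=\int_S\kappa(s,A)\,\mu(\mathrm ds)$; $\alpha_\#(\mu)(M)=\mu(\alpha^{-1}(M))$. $\mathcal T_2$ is an $\alpha$-abstraction of $\mathcal T_1$ if for every $\mu\in\mathrm{Dist}(S_1)$ the measures $\alpha_\#(\Omega_{\mathcal T_1}(\mu))$ and $\Omega_{\mathcal T_2}(\alpha_\#(\mu))$ have the same null sets. A set $B\in\Sigma_1$ is $\alpha$-closed if $B=\alpha^{-1}(\alpha(B))$. *)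

(* Defs.v *)
From HB Require Import structures.
From mathcomp Require Import all_boot all_order all_algebra.
From mathcomp Require Import all_classical all_reals all_analysis.
From mathcomp Require Import measurable_realfun.

Set Implicit Arguments.
Unset Strict Implicit.
Unset Printing Implicit Defensive.
Import Order.TTheory GRing.Theory Num.Theory.
Import numFieldNormedType.Exports.
Local Open Scope classical_set_scope.
Local Open Scope ring_scope.
Local Open Scope ereal_scope.

Section path_space.
Context d (S : measurableType d).

Definition coordinate_sets : set (set (nat -> S)) :=
  [set C | exists i (A : set S), measurable A /\ C = [set w | A (w i)]].

Definition path_space := g_sigma_algebraType coordinate_sets.

Lemma measurable_coord i : measurable_fun [set: path_space] (fun w : path_space => w i).
Proof.
move=> _ A mA; rewrite setTI; apply: sub_sigma_algebra.
by exists i, A.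
Qed.

End path_space.
Arguments coordinate_sets {d} S.
Arguments measurable_coord {d S} i.

Section path_law.
Context d (S : measurableType d) (R : realType).
Variables (k : R.-pker S ~> S) (mu : probability S R).

(* Probability, for the chain started in [s], that its states at times
   1, ..., n lie in [A 0], ..., [A n.-1] respectively. *)
Fixpoint visit_prob (n : nat) (A : nat -> set S) (s : S) : \bar R :=
  if n is m.+1 then \int[k s]_(t in A 0%N) visit_prob m (fun i => A i.+1) t
  else 1.

(* The values on cylinders determine the law of the Markov chain: see
   [path_law_unique] and [IonescuTulcea.path_law_exists] below. *)
Definition is_path_law (P : probability (path_space S) R) :=
  forall (n : nat) (A : nat -> set S), (forall i, measurable (A i)) ->
    P [set w | forall i, (i <= n)%N -> A i (w i)] =
    \int[mu]_(s in A 0%N) visit_prob n (fun i => A i.+1) s.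

End path_law.

(* Existence of the path law on an arbitrary measurable space. *)
Module IonescuTulcea.
Section ionescu_tulcea.
Context d (S : measurableType d) (R : realType).
Variables (k : R.-pker S ~> S) (mu : probability S R).
Notation X := (path_space S).

Definition next_law (n : nat) (w : X) : {measure set S -> \bar R} :=
  if n is m.+1 then k (w m) else mu.

Lemma measurable_next_law n U : measurable U ->
  measurable_fun [set: X] (next_law n ^~ U).
Proof.
move=> mU; case: n => [|n]; first exact: measurable_cst.
exact: (measurableT_comp (measurable_kernel k U mU) (measurable_coord n)).
Qed.

HB.instance Definition _ n :=
  isKernel.Build _ _ _ _ _ (next_law n) (@measurable_next_law n).

Lemma next_lawT n w : next_law n w setT = 1.
Proof. by case: n => [|n] /=; rewrite ?probability_setT ?prob_kernel. Qed.

HB.instance Definition _ n :=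
  Kernel_isProbability.Build _ _ _ _ _ (next_law n) (@next_lawT n).

Definition upd (w : X) (n : nat) (s : S) : X := fun i => if i == n then s else w i.

Lemma measurable_upd n : measurable_fun [set: X * S] (fun z => upd z.1 n z.2).
Proof.
have := @measurability _ _ (X * S)%type X setT (fun z => upd z.1 n z.2)
  (coordinate_sets S); apply => //.
move=> _ [_ [i [A [mA ->]]] <-]; rewrite setTI.
rewrite [X in measurable X](_ : _ =
    (fun z : X * S => if i == n then z.2 else z.1 i) @^-1` A)//.
case: (i == n).
  by rewrite -[X in measurable X]setTI; exact: measurable_snd.
rewrite -[X in measurable X]setTI.
by apply: (measurableT_comp (measurable_coord i)).
Qed.

Definition step n (f : X -> \bar R) (w : X) : \bar R :=
  \int[next_law n w]_s f (upd w n s).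

Lemma measurable_step n f : (forall w, 0 <= f w) -> measurable_fun setT f ->
  measurable_fun setT (step n f).
Proof.
move=> f0 mf.
apply: (@measurable_fun_integral_finite_kernel _ _ _ _ _
  (fun z : X * S => f (upd z.1 n z.2)) (next_law n)) => //.
exact: (measurableT_comp mf (measurable_upd n)).
Qed.

Lemma measurable_section n (f : X -> \bar R) w : measurable_fun setT f ->
  measurable_fun [set: S] (fun s => f (upd w n s)).
Proof.
move=> mf; apply: (measurableT_comp mf).
exact: (measurableT_comp (measurable_upd n) (measurable_pair1 _)).
Qed.

Lemma step_ge0 n f w : (forall w, 0 <= f w) -> 0 <= step n f w.
Proof. by move=> f0; apply: integral_ge0 => s _. Qed.

Fixpoint steps m j (f : X -> \bar R) : X -> \bar R :=
  if m is m'.+1 then step j (steps m' j.+1 f) else f.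

Lemma steps_ge0 m j f w : (forall w, 0 <= f w) -> 0 <= steps m j f w.
Proof. by move=> f0; elim: m j w => [|m IH] j w //=; exact: step_ge0. Qed.

Lemma measurable_steps m j f : (forall w, 0 <= f w) -> measurable_fun setT f ->
  measurable_fun setT (steps m j f).
Proof.
move=> f0 mf; elim: m j => [|m IH] j //=.
by apply: measurable_step => // w; exact: steps_ge0.
Qed.

Definition agree n (w w' : X) := forall i, (i < n)%N -> w i = w' i.

Lemma stepsS m j f : (forall w w', agree (j + m) w w' -> f w = f w') ->
  steps m.+1 j f = steps m j f.
Proof.
elim: m j => [|m IH] j fE; last first.
  by rewrite [LHS]/= -[step j _]/(step j (steps m.+1 j.+1 f)) IH// addSnnS.
apply/funext => w /=; rewrite /step.
under eq_integral.
  move=> s _; rewrite (fE _ w); last first.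
    by move=> i; rewrite addn0 /upd; case: eqP => // ->; rewrite ltnn.
  over.
by rewrite integral_cst// next_lawT mule1.
Qed.

Lemma stepsD m j f : (forall w w', agree j w w' -> f w = f w') ->
  steps m j f = f.
Proof.
elim: m => [//|m IH] fE; rewrite stepsS ?IH// => w w' ww'.
by apply: fE => i ij; apply: ww'; rewrite (leq_trans ij)// leq_addr.
Qed.

Lemma stepsE n m m' j f : (forall w w', agree n w w' -> f w = f w') ->
  (n <= j + m)%N -> (n <= j + m')%N -> steps m j f = steps m' j f.
Proof.
move=> fE; wlog mm' : m m' / (m <= m')%N.
  by move=> h nm nm'; case: (leqP m m') => [|/ltnW] /h ->.
move=> nm _; rewrite -(subnKC mm'); elim: (m' - m)%N => [|p IH].
  by rewrite addn0.
rewrite addnS stepsS// => w w' ww'; apply: fE => i ni; apply: ww'.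
by rewrite (leq_trans ni)// (leq_trans nm)// leq_add2l leq_addr.
Qed.

Lemma eq_steps m j f g : f =1 g -> steps m j f =1 steps m j g.
Proof. by move=> /funext ->. Qed.

Lemma steps_add m j f g : (forall w, 0 <= f w) -> (forall w, 0 <= g w) ->
  measurable_fun setT f -> measurable_fun setT g ->
  steps m j (fun w => f w + g w) = fun w => steps m j f w + steps m j g w.
Proof.
move=> f0 g0 mf mg; elim: m j => [//|m IH] j /=; rewrite IH.
apply/funext => w; rewrite /step ge0_integralD//.
- by move=> s _; exact: steps_ge0.
- by apply: measurable_section; exact: measurable_steps.
- by move=> s _; exact: steps_ge0.
- by apply: measurable_section; exact: measurable_steps.
Qed.

Lemma steps_le m j f g w : (forall w, 0 <= f w) -> (forall w, 0 <= g w) ->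
  measurable_fun setT f -> measurable_fun setT g ->
  (forall w, f w <= g w) -> steps m j f w <= steps m j g w.
Proof.
move=> f0 g0 mf mg fg; elim: m j w => [//|m IH] j w /=.
apply: ge0_le_integral => //.
- by move=> s _; exact: steps_ge0.
- by apply: measurable_section; exact: measurable_steps.
- by apply: measurable_section; exact: measurable_steps.
Qed.

Definition cylinder n (A : set X) :=
  measurable A /\ (forall w w', agree n w w' -> A w -> A w').

Definition cylinders : set (set X) := [set A | exists n, cylinder n A].

Definition ind (A : set X) (w : X) : \bar R := (\1_A w)%:E.

Lemma ind_ge0 A w : 0 <= ind A w.
Proof. by rewrite lee_fin. Qed.

Lemma measurable_ind A : measurable A -> measurable_fun setT (ind A).
Proof. by move=> mA; apply/measurable_EFinP; exact: measurable_indic. Qed.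

Lemma agree_sym n w w' : agree n w w' -> agree n w' w.
Proof. by move=> ww' i /ww'. Qed.

Lemma agree_le m n w w' : (m <= n)%N -> agree n w w' -> agree m w w'.
Proof. by move=> mn ww' i im; apply: ww'; exact: leq_trans mn. Qed.

Lemma cylinder_ind n A w w' : cylinder n A -> agree n w w' ->
  ind A w = ind A w'.
Proof.
move=> [_ cA] ww'; rewrite /ind !indicE.
suff -> : (w \in A) = (w' \in A) by [].
by apply/idP/idP => /set_mem Aw; apply/mem_set; apply: cA Aw => //; exact: agree_sym.
Qed.

Definition depth (A : set X) : nat :=
  if pselect (exists n, cylinder n A) is left e then projT1 (cid e) else 0%N.

Lemma depthP A : cylinders A -> cylinder (depth A) A.
Proof. by move=> cA; rewrite /depth; case: pselect => // e; case: cid. Qed.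

(* Conditional probability of the cylinder [A] given the first [j] states. *)
Definition cond j (A : set X) : X -> \bar R := steps (depth A - j) j (ind A).

Lemma condE j m n A : cylinder n A -> (n <= j + m)%N ->
  cond j A = steps m j (ind A).
Proof.
move=> cA nm; have dA : cylinder (depth A) A by apply: depthP; exists n.
have hA w w' : agree n w w' -> ind A w = ind A w' by exact: cylinder_ind.
have hd w w' : agree (depth A) w w' -> ind A w = ind A w'.
  exact: cylinder_ind.
rewrite /cond (stepsE hd (m' := maxn (depth A) n)).
- by rewrite (stepsE hA (m' := m))// (leq_trans (leq_maxr (depth A) n))// leq_addl.
- by rewrite -leq_subLR.
- by rewrite (leq_trans (leq_maxl _ n))// leq_addl.
Qed.

Lemma cond_step j A : cylinders A -> cond j A = step j (cond j.+1 A).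
Proof.
move=> [n cA]; rewrite (condE (m := n.+1) cA) ?(condE (m := n) cA)//.
- by rewrite leq_addl.
- by rewrite (leq_trans (leqnSn n))// leq_addl.
Qed.

Lemma cond_ind j n A : cylinder n A -> (n <= j)%N -> cond j A = ind A.
Proof. by move=> cA nj; rewrite (condE (m := 0) cA)// addn0. Qed.

Lemma cond_ge0 j A w : 0 <= cond j A w.
Proof. by apply: steps_ge0 => ?; exact: ind_ge0. Qed.

Lemma measurable_cond j A : cylinders A -> measurable_fun setT (cond j A).
Proof.
move=> [n [mA _]]; apply: measurable_steps => [?|]; first exact: ind_ge0.
exact: measurable_ind.
Qed.

Lemma cond_subadditive (A : set X) (F : nat -> set X) w0 :
  cylinders A -> (forall i, cylinders (F i)) -> A `<=` \bigcup_i F i ->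
  cond 0 A w0 <= \sum_(i <oo) cond 0 (F i) w0.
Proof.
move=> cA cF AF; rewrite leNgt; apply/negP => bad0.
pose bad j w := \sum_(i <oo) cond j (F i) w < cond j A w.
have badS (p : nat * X) :
    exists s, bad p.1 p.2 -> bad p.1.+1 (upd p.2 p.1 s).
  case: p => j w /=.
  have [bj|] := pselect (bad j w); last by exists point.
  apply: contrapT => nex.
  have nbad s : ~ bad j.+1 (upd w j s) by move=> b; apply: nex; exists s.
  have : cond j A w <= \sum_(i <oo) cond j (F i) w.
    rewrite cond_step//; under eq_eseriesr do rewrite cond_step//.
    rewrite /step -integral_nneseries//.
    - apply: ge0_le_integral => //.
      + by move=> s _; exact: cond_ge0.
      + by apply: measurable_section; exact: measurable_cond.
      + apply: ge0_emeasurable_sum => [i s _ _|i _]; first exact: cond_ge0.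
        by apply: measurable_section; exact: measurable_cond.
      + by move=> s _; rewrite leNgt; apply/negP => /(nbad s).
    - by move=> i; apply: measurable_section; exact: measurable_cond.
    - by move=> i s _; exact: cond_ge0.
  by rewrite leNgt => /negP; exact.
have [c cP] := choice badS.
pose fix ws n : X := if n is m.+1 then upd (ws m) m (c (m, ws m)) else w0.
have bad_ws n : bad n (ws n).
  by elim: n => [//|n IH]; exact: (cP (n, ws n)).
pose w : X := fun i => ws i.+1 i.
have agw n : agree n (ws n) w.
  elim: n => [//|n IH] i; rewrite ltnS leq_eqVlt => /predU1P[->//|ni].
  by rewrite -IH// /= /upd ltn_eqF.
have [N cAN] := cA.
have Aw : A w.
  have := bad_ws N; rewrite /bad (cond_ind cAN)// (cylinder_ind cAN (agw N)).
  rewrite /ind indicE; case: (boolP (w \in A)) => [/set_mem //|_].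
  by rewrite ltNge nneseries_ge0// => i _ _; exact: cond_ge0.
have [i _ Fiw] := AF _ Aw; have [M cFM] := cF i.
pose J := maxn N M.
have := bad_ws J; rewrite /bad ltNge => /negP; apply.
rewrite (cond_ind cAN) ?leq_maxl// (cylinder_ind cAN (agree_le (leq_maxl _ _) (agw J))).
rewrite (@le_trans _ _ (cond J (F i) (ws J)))//.
  rewrite (cond_ind cFM) ?leq_maxr//.
  rewrite (cylinder_ind cFM (agree_le (leq_maxr _ _) (agw J))).
  by rewrite /ind !indicE !mem_set.
rewrite (@nneseriesD1 _ _ i)//=; last by move=> ? _; exact: cond_ge0.
by rewrite leeDl// nneseries_ge0// => ? _ _; exact: cond_ge0.
Qed.

Lemma cylinder_le m n A : (m <= n)%N -> cylinder m A -> cylinder n A.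
Proof.
by move=> mn [mA cA]; split => // w w' /(agree_le mn); exact: cA.
Qed.

Lemma cylinders0 : cylinders set0.
Proof. by exists 0%N; split. Qed.

Lemma cylindersU : setU_closed cylinders.
Proof.
move=> A B [m /(cylinder_le (leq_maxl m _)) cA].
move=> [n /(cylinder_le (leq_maxr m _)) cB].
have [[mA hA] [mB hB]] := (cA n, cB).
exists (maxn m n); split; first exact: measurableU.
by move=> w w' ww' [/(hA _ _ ww')|/(hB _ _ ww')]; [left|right].
Qed.

Lemma cylindersC : setC_closed cylinders.
Proof.
move=> A [m [mA hA]]; exists m; split; first exact: measurableC.
by move=> w w' /agree_sym ww' nAw /(hA _ _ ww').
Qed.

Definition cyl_type := nat -> S.

HB.instance Definition _ := Pointed.on cyl_type.
HB.instance Definition _ := @isAlgebraOfSets.Build default_measure_display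
  cyl_type cylinders cylinders0 cylindersU cylindersC.

Definition cyl_content (A : set cyl_type) : \bar R := cond 0 A point.

Lemma cyl_content0 : cyl_content set0 = 0.
Proof.
have c0 : cylinder 0 set0 by split.
by rewrite /cyl_content (cond_ind c0)// /ind indic0.
Qed.

Lemma cyl_content_ge0 A : 0 <= cyl_content A.
Proof. exact: cond_ge0. Qed.

Lemma cyl_content_additive : measure_function.semi_additive cyl_content.
Proof.
apply/(additive2P cyl_content0) => A B.
move=> [m /(cylinder_le (leq_maxl m _)) cA].
move=> [n /(cylinder_le (leq_maxr m _)) cB] AB0.
have {}cA := cA n.
have cAB : cylinder (maxn m n) (A `|` B).
  case: cA cB => [mA hA] [mB hB]; split; first exact: measurableU.
  by move=> w w' ww' [/(hA _ _ ww')|/(hB _ _ ww')]; [left|right].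
rewrite /cyl_content (condE (m := maxn m n) cA)// (condE (m := maxn m n) cB)//.
rewrite (condE (m := maxn m n) cAB)//.
have -> : ind (A `|` B) = fun w => ind A w + ind B w.
  apply/funext => w; rewrite /ind -EFinD !indicE in_setU.
  case: (boolP (w \in A)) => [/set_mem Aw|_]; last by rewrite add0r.
  case: (boolP (w \in B)) => [/set_mem Bw|_]; last by rewrite addr0.
  by have : (A `&` B) w by []; rewrite AB0.
rewrite steps_add//.
- by move=> w; exact: ind_ge0.
- by move=> w; exact: ind_ge0.
- by apply: measurable_ind; case: cA.
- by apply: measurable_ind; case: cB.
Qed.

HB.instance Definition _ := isContent.Build _ cyl_type R cyl_content
  cyl_content_ge0 cyl_content_additive.

Lemma cyl_content_sigma_subadditive :
  measurable_subset_sigma_subadditive cyl_content.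
Proof. by move=> A F cF cA AF; exact: cond_subadditive. Qed.

HB.instance Definition _ := Content_SigmaSubAdditive_isMeasure.Build _ _ _
  cyl_content cyl_content_sigma_subadditive.

Definition cyl_measure (A : set X) : \bar R := measure_extension cyl_content A.

Lemma cyl_measureE A : cylinders A -> cyl_measure A = cond 0 A point.
Proof.
move=> cA; rewrite /cyl_measure /measure_extension.
exact: (measurable_mu_extE cyl_content).
Qed.

Lemma measurable_cyl_type (A : set X) : measurable A ->
  <<s cylinders >> A.
Proof.
apply: smallest_sub; first exact: smallest_sigma_algebra.
move=> _ [i [B [mB ->]]]; apply: sub_sigma_algebra.
exists i.+1; split; last by move=> w w' /= ww'; rewrite ww'.
rewrite [Y in measurable Y](_ : _ = (fun w : X => w i) @^-1` B)//.
by rewrite -[Y in measurable Y]setTI; exact: measurable_coord.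
Qed.

Lemma cyl_measure0 : cyl_measure set0 = 0.
Proof. exact: (measure0 (measure_extension cyl_content)). Qed.

Lemma cyl_measure_ge0 A : 0 <= cyl_measure A.
Proof. exact: (measure_ge0 (measure_extension cyl_content)). Qed.

Lemma cyl_measure_sigma_additive : semi_sigma_additive cyl_measure.
Proof.
move=> F mF tF mUF.
apply: (@measure_semi_sigma_additive _ _ _ (measure_extension cyl_content)) => //.
- by move=> i; exact: measurable_cyl_type.
- exact: measurable_cyl_type.
Qed.

HB.instance Definition _ := isMeasure.Build _ X R cyl_measure
  cyl_measure0 cyl_measure_ge0 cyl_measure_sigma_additive.

Lemma cyl_measureT : cyl_measure setT = 1.
Proof.
have cT : cylinder 0 setT by split.
rewrite cyl_measureE; last by exists 0%N.
by rewrite (cond_ind cT)// /ind indicT.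
Qed.

HB.instance Definition _ := Measure_isProbability.Build _ _ _ cyl_measure
  cyl_measureT.

Definition box j n (A : nat -> set S) : set X :=
  [set w | forall i, (i < n)%N -> A i (w (j + i)%N)].

Lemma cylinder_box n A : (forall i, measurable (A i)) -> cylinder n (box 0 n A).
Proof.
move=> mA; split; last first.
  by move=> w w' ww' Aw i /= ni; rewrite -ww'//; exact: Aw.
rewrite (_ : box 0 n A = \bigcap_(i in `I_n) (fun w : X => w i) @^-1` A i)//.
apply: bigcap_measurableType => i _.
by rewrite -[Y in measurable Y]setTI; exact: measurable_coord.
Qed.

Lemma steps_mulind m i j (A : set S) (f : X -> \bar R) w : (i < j)%N ->
  steps m j (fun w => (\1_A (w i))%:E * f w) w = (\1_A (w i))%:E * steps m j f w.
Proof.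
elim: m j w => [//|m IH] j w ij /=; rewrite /step.
under eq_integral.
  move=> s _; rewrite IH ?(ltnW ij)// ?ltnS ?(ltnW ij)//.
  rewrite [upd w j s i](_ : _ = w i); last by rewrite /upd ltn_eqF.
  over.
rewrite indicE; case: (_ \in _).
  by under eq_integral do rewrite mul1e; rewrite mul1e.
by under eq_integral do rewrite mul0e; rewrite integral0 mul0e.
Qed.

Lemma steps_box n j A w :
  steps n j (ind (box j n A)) w =
  if n is m.+1 then
    \int[next_law j w]_(s in A 0%N) visit_prob k m (fun i => A i.+1) s
  else 1.
Proof.
elim: n j A w => [|n IH] j A w.
  by rewrite /= /ind indicE mem_set.
rewrite /= [RHS]integral_mkcond; apply: eq_integral => s _.
have -> : ind (box j n.+1 A) =
    fun w => (\1_(A 0%N) (w j))%:E * ind (box j.+1 n (fun i => A i.+1)) w.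
  apply/funext => w'; rewrite /ind -EFinM !indicE.
  rewrite -natrM mulnb; congr (_%:R%:E); congr nat_of_bool.
  apply/idP/andP => [/set_mem h|[/set_mem h0 /set_mem h]].
    split; apply/mem_set; first by have := h 0%N isT; rewrite addn0.
    by move=> i ni; have := h i.+1 ni; rewrite addnS addSn.
  apply/mem_set => -[|i] ni; first by rewrite addn0.
  by have := h i ni; rewrite addnS addSn.
rewrite steps_mulind// IH patchE indicE.
have -> : upd w j s j = s by rewrite /upd eqxx.
case: (s \in A 0%N); last by rewrite mul0e.
by rewrite mul1e; case: n {IH} => //= n; rewrite /upd eqxx.
Qed.

Lemma cyl_measure_law : is_path_law k mu cyl_measure.
Proof.
move=> n A mA.
have -> : [set w : X | forall i, (i <= n)%N -> A i (w i)] = box 0 n.+1 A by [].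
have cb := cylinder_box n.+1 mA.
rewrite -[LHS]/(cyl_measure (box 0 n.+1 A)) cyl_measureE; last by exists n.+1.
by rewrite (condE (m := n.+1) cb)// steps_box.
Qed.

End ionescu_tulcea.

Lemma path_law_exists d (S : measurableType d) (R : realType)
    (k : R.-pker S ~> S) (mu : probability S R) :
  exists P : probability (path_space S) R, is_path_law k mu P.
Proof. by exists (cyl_measure k mu); exact: cyl_measure_law. Qed.

End IonescuTulcea.

Lemma path_law_unique d (S : measurableType d) (R : realType)
    (k : R.-pker S ~> S) (mu : probability S R)
    (P Q : probability (path_space S) R) :
  is_path_law k mu P -> is_path_law k mu Q ->
  forall E, measurable E -> P E = Q E.
Proof.
move=> hP hQ.
pose G := [set C : set (path_space S) | exists n (A : nat -> set S),
  (forall i, measurable (A i)) /\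
  C = [set w | forall i, (i <= n)%N -> A i (w i)]].
have GT : G setT.
  exists 0%N, (fun=> setT); split => //.
  by apply/seteqP; split.
have mG : @measurable _ (path_space S) = <<s G >>.
  apply/seteqP; split; apply: smallest_sub.
  - exact: smallest_sigma_algebra.
  - move=> _ [i [B [mB ->]]]; apply: sub_sigma_algebra.
    exists i, (fun j => if j == i then B else setT); split.
      by move=> j; case: ifP.
    apply/seteqP; split => [w /= Bw j _|w /= /(_ i (leqnn i))].
      by case: ifP => // /eqP ->.
    by rewrite eqxx.
  - exact: sigma_algebra_measurable.
  - move=> _ [n [A [mA ->]]].
    rewrite (_ : [set w | _] = \bigcap_(i in [set i | (i <= n)%N])
      (fun w : path_space S => w i) @^-1` A i)//.
    apply: bigcap_measurable => [|i _]; first by exists 0%N.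
    by rewrite -[Y in measurable Y]setTI; exact: measurable_coord.
apply: (measure_unique G (fun=> setT)) => //.
- move=> _ _ [m [A [mA ->]]] [n [B [mB ->]]].
  exists (maxn m n), (fun i => (if (i <= m)%N then A i else setT) `&`
    (if (i <= n)%N then B i else setT)); split.
    by move=> i; apply: measurableI; case: ifP.
  apply/seteqP; split => [w [hA hB] i _|w h]/=.
    by split; case: ifP => // ?; [exact: hA|exact: hB].
  split=> i im.
    by have [] := h i (leq_trans im (leq_maxl _ _)); rewrite im.
  by have [_] := h i (leq_trans im (leq_maxr _ _)); rewrite im.
- by rewrite bigcup_const.
- by move=> _ [n [A [mA ->]]]; exact: etrans (hP n A mA) (esym (hQ n A mA)).
- by move=> _; rewrite (@le_lt_trans _ _ 1) ?ltry//; exact: (probability_le1 P).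
Qed.

Section transition_system.
Context d (S : measurableType d) (R : realType).
Variable k : R.-pker S ~> S.
Implicit Types (mu : probability S R) (B : set S).

Definition path_law mu : probability (path_space S) R :=
  projT1 (cid (IonescuTulcea.path_law_exists k mu)).

Lemma path_lawP mu : is_path_law k mu (path_law mu).
Proof. exact: (projT2 (cid _)). Qed.

Definition eventually_in B : set (path_space S) :=
  [set w | exists i, B (w i)].

Definition infinitely_often_in B : set (path_space S) :=
  [set w | infinite_set [set i | B (w i)]].

Definition avoid_set B : set S :=
  [set s | path_law (dirac s) (eventually_in B) = 0].

Definition decisive mu B :=
  path_law mu (eventually_in B `|` eventually_in (avoid_set B)) = 1.

Definition cond_prob d' (T : measurableType d') (P : probability T R)
  (E F : set T) : \bar R := P (E `&` F) / P F.

Definition fair mu B := forall B', measurable B' ->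
  (forall mu', mu' B' = 1 ->
    0 < path_law mu' [set w | B' (w 0%N) /\ B (w 1%N)]) ->
  0 < path_law mu (infinitely_often_in B') ->
  cond_prob (path_law mu) (infinitely_often_in B) (infinitely_often_in B') = 1.

Definition one_step mu : set S -> \bar R := fun A => \int[mu]_s k s A.

End transition_system.

Section abstraction.
Context d1 d2 (S1 : measurableType d1) (S2 : measurableType d2).
Variables (R : realType) (alpha : {mfun S1 >-> S2}).

(* [distribution mu alpha] is the pushforward of [mu] by [alpha], as a
   probability measure. *)
Definition is_abstraction (k1 : R.-pker S1 ~> S1) (k2 : R.-pker S2 ~> S2) :=
  forall (mu : probability S1 R) (A : set S2), measurable A ->
    pushforward (one_step k1 mu) alpha A = 0 <->
    one_step k2 (distribution mu alpha) A = 0.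

Definition alpha_closed (B : set S1) := B = alpha @^-1` (alpha @` B).

End abstraction.

(* Main.v *)
(* Write B as the preimage of C, and draw an edge x -> y between states of the
   finite chain when k2 x {y} > 0. Applying the abstraction hypothesis to Dirac
   measures shows that k1 s gives positive mass to the preimage of y if and only
   if alpha s -> y. Hence the avoid-set of B is exactly the preimage of the
   states that cannot reach C, and in particular it is measurable. By fairness,
   if x -> y then almost every path visiting the fibre of x infinitely often
   also visits the fibre of y infinitely often, so if x reaches C then almost
   every such path meets B. By the pigeonhole principle every path visits some
   fibre infinitely often: that of a state reaching C, or one inside the
   avoid-set. *)
Require Import Defs.
From mathcomp Require Import all_boot all_order all_algebra.
From mathcomp Require Import all_classical all_reals all_analysis.
From mathcomp Require Import measurable_realfun.
Local Open Scope classical_set_scope.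

Set Implicit Arguments.
Unset Strict Implicit.
Unset Printing Implicit Defensive.
Import Order.TTheory GRing.Theory Num.Theory.
Local Open Scope ring_scope.
Local Open Scope ereal_scope.

(** * Null sets and positivity of integrals *)

Section measure_complements.
Context d (T : measurableType d) (R : realType) (m : {measure set T -> \bar R}).

Lemma measure_bigcup_finite0 (I : choiceType) (D : set I) (F : I -> set T) :
  finite_set D -> (forall i, D i -> measurable (F i)) ->
  (forall i, D i -> m (F i) = 0) -> m (\bigcup_(i in D) F i) = 0.
Proof.
move=> finD mF F0; apply/eqP; rewrite eq_le measure_ge0 andbT.
have := @content_sub_fsum _ _ _ m _ D _ F finD mF (fin_bigcup_measurable finD mF)
  (@subset_refl _ _).
by rewrite fsbig1.
Qed.

(** A zero integral would make [f] vanish almost everywhere on [A]; as [f] is positive there, [A]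
    would be null. *)
Lemma integral_gt0 (A : set T) (f : T -> \bar R) : measurable A ->
  measurable_fun A f -> (forall t, A t -> 0 < f t) -> 0 < m A ->
  0 < \int[m]_(t in A) f t.
Proof.
move=> mA mf f0 A0.
have If0 : 0 <= \int[m]_(t in A) f t by apply: integral_ge0 => t /f0/ltW.
rewrite lt_neqAle If0 andbT; apply/eqP => /esym I0.
have := (ae_eq_integral_abs m mA mf).1; case.
  rewrite -I0; apply: eq_integral => t; rewrite inE => /f0 /ltW.
  exact: gee0_abs.
move=> N [mN N0 AN]; move: A0; rewrite lt_neqAle => /andP[/eqP + _]; apply.
apply/esym/eqP; rewrite eq_le measure_ge0 andbT -N0.
apply: le_measure; rewrite ?inE// => t At; apply: AN => /= /(_ At) ft0.
by have := f0 _ At; rewrite ft0 ltxx.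
Qed.

End measure_complements.

Inductive reaches (T : Type) (E : T -> T -> Prop) (C : set T) : T -> Prop :=
| reaches_here x : C x -> reaches E C x
| reaches_step x y : E x y -> reaches E C y -> reaches E C x.

(** * Path events of a single chain: cylinders, avoid-sets, fairness *)

Section chain.
Context d (S : measurableType d) (R : realType) (k : R.-pker S ~> S).

Lemma visit_prob_ge0 n (A : nat -> set S) s : 0 <= visit_prob k n A s.
Proof.
by elim: n A s => [|n IH] A s //=; apply: integral_ge0 => t _; exact: IH.
Qed.

Lemma measurable_visit_prob n (A : nat -> set S) : (forall i, measurable (A i)) ->
  measurable_fun setT (visit_prob k n A).
Proof.
elim: n A => [|n IH] A mA /=; first exact: measurable_cst.
under eq_fun do rewrite integral_mkcond.
apply: measurable_fun_integral_kernel => [U mU|t|].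
- exact: measurable_kernel.
- by apply: erestrict_ge0 => u _; exact: visit_prob_ge0.
- apply/(measurable_restrictT _ _).1 => //.
  by apply: measurable_funTS; apply: IH.
Qed.

Lemma path_law_dirac s n (A : nat -> set S) : (forall i, measurable (A i)) ->
  A 0%N s ->
  path_law k (dirac s) [set w | forall i, (i <= n)%N -> A i (w i)] =
  visit_prob k n (fun i => A i.+1) s.
Proof.
move=> mA As; rewrite path_lawP// integral_dirac//.
  by rewrite diracE mem_set// mul1e.
by apply: measurable_funTS; apply: measurable_visit_prob.
Qed.

Lemma path_law_two_steps (mu : probability S R) (A B : set S) :
  measurable A -> measurable B ->
  path_law k mu [set w | A (w 0%N) /\ B (w 1%N)] = \int[mu]_(s in A) k s B.
Proof.
move=> mA mB; pose C i := if i is 0%N then A else B.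
have -> : [set w | A (w 0%N) /\ B (w 1%N)] =
    [set w : path_space S | forall i, (i <= 1)%N -> C i (w i)].
  apply/seteqP; split => [w [Aw Bw] [|[|//]]//|w h].
  by split; [exact: (h 0%N)|exact: (h 1%N)].
rewrite path_lawP /=; last by case.
by apply: eq_integral => s _; rewrite integral_cst// mul1e.
Qed.

Lemma measurable_coord_preimage i (B : set S) : measurable B ->
  measurable [set w : path_space S | B (w i)].
Proof. by move=> mB; rewrite -[X in measurable X]setTI; exact: measurable_coord. Qed.

Lemma eventually_inE (B : set S) :
  eventually_in B = \bigcup_i [set w : path_space S | B (w i)].
Proof. by apply/seteqP; split=> w [i]; [exists i|exists i]. Qed.

Lemma measurable_eventually_in (B : set S) : measurable B ->
  measurable (eventually_in B).
Proof.
move=> mB; rewrite eventually_inE; apply: bigcup_measurable => i _.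
exact: measurable_coord_preimage.
Qed.

(** Displays the event as a countable intersection of countable unions, whence its measurability. *)
Lemma infinitely_often_inE (B : set S) : infinitely_often_in B =
  lim_sup_set (fun i => [set w : path_space S | B (w i)]).
Proof.
apply/seteqP; split=> w /=.
  move=> infB n _; apply: contrapT => nB; apply: infB.
  apply: (@sub_finite_set _ _ `I_n); last exact: finite_II.
  move=> i /= Bi; rewrite ltnNge; apply/negP => ni.
  by apply: nB; exists i.
move=> h /finite_seqP[s sE].
(* [s] lists all visit times, yet the limsup yields a visit after their maximum. *)
have [i /= + Bi] := h (\max_(j <- s) j).+1 I.
have : i \in s by have : [set i | B (w i)] i by []; rewrite sE.
move=> /(fun h => @leq_bigmax_seq nat s xpredT id i h isT).
by rewrite leqNgt => /negP.
Qed.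

Lemma measurable_infinitely_often_in (B : set S) : measurable B ->
  measurable (infinitely_often_in B).
Proof.
move=> mB; rewrite infinitely_often_inE; apply: bigcap_measurable => [|n _].
  by exists 0%N.
by apply: bigcup_measurable => i _; exact: measurable_coord_preimage.
Qed.

(** From [N] every step stays in [N] up to a null set, while the last required set [A n] misses
    [N]. *)
Lemma visit_prob_absorbing n (N : set S) (A : nat -> set S) s :
  measurable N -> (forall t, N t -> k t (~` N) = 0) ->
  (forall i, measurable (A i)) -> A n `<=` ~` N -> N s ->
  visit_prob k n.+1 A s = 0.
Proof.
move=> mN absN; elim: n A s => [|n IH] A s mA AN Ns.
  rewrite /= integral_cst// mul1e.
  exact: subset_measure0 (mA 0%N) (measurableC mN) AN (absN _ Ns).
rewrite [LHS]/= -[X in integral _ _ X]/(visit_prob k n.+1 (fun i => A i.+1)).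
(* Exits from [N] are [k s]-null, so the integral restricts to points of [N], where the induction
   hypothesis applies. *)
rewrite (ge0_negligible_integral (measurableC mN) (mA 0%N) _ _ (absN _ Ns)).
- by apply: integral0_eq => t [_ /contrapT Nt]; exact: (IH (fun i => A i.+1)).
- by apply: measurable_funTS; exact: (measurable_visit_prob n.+1 (fun i => mA i.+1)).
- by move=> t _; exact: (visit_prob_ge0 n.+1 (fun i => A i.+1)).
Qed.

(** By countable subadditivity, it suffices that a visit to [B] at each fixed time is null. *)
Lemma absorbing_sub_avoid_set (N B : set S) : measurable N -> measurable B ->
  (forall t, N t -> k t (~` N) = 0) -> B `<=` ~` N -> N `<=` avoid_set k B.
Proof.
move=> mN mB absN BN s Ns; rewrite /avoid_set /= eventually_inE.
have mC i := measurable_coord_preimage i mB.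
suff B0 i : path_law k (dirac s) [set w | B (w i)] = 0.
  apply/eqP; rewrite eq_le measure_ge0 andbT.
  apply: le_trans (measure_sigma_subadditive _ mC _ (@subset_refl _ _)) _.
    exact: bigcup_measurable.
  by rewrite eseries0// => i _ _; exact: B0.
(* A visit at time [i] is a cylinder constrained at that time only. For [i = 0] it excludes the
   starting point [s], hence the guard in [A0] and the separate case. *)
pose A j := if j == i then B else setT.
have mA j : measurable (A j) by rewrite /A; case: ifP.
have Ai : A i `<=` ~` N by rewrite /A eqxx.
have A0 : (0 < i)%N -> A 0%N s by rewrite /A; case: i {A mA Ai}.
rewrite (_ : [set w | _] =
    [set w : path_space S | forall j, (j <= i)%N -> A j (w j)]); last first.
  apply/seteqP; split=> [w /= Bw j _|w /= /(_ i (leqnn i))].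
    by rewrite /A; case: eqP => // ->.
  by rewrite /A eqxx.
move: A mA Ai A0 => {mC}; case: i => [|i] A mA Ai A0.
  rewrite path_lawP//= integral_dirac//= diracE memNset ?mul0e//.
  by move=> /Ai.
rewrite path_law_dirac//; last exact: A0.
exact: (visit_prob_absorbing mN absN (fun i => mA i.+1)).
Qed.

(** The sets [A] are the fibres along a path from [x] to [C]. Recording [A 0%N = F x] lets the
    induction prepend an edge. *)
Lemma reaches_cylinder (T : Type) (E : T -> T -> Prop) (F : T -> set S)
    (C : set T) x :
  (forall x, measurable (F x)) ->
  (forall x y, E x y -> forall s, F x s -> 0 < k s (F y)) ->
  reaches E C x ->
  exists n (A : nat -> set S), [/\ forall i, measurable (A i), A 0%N = F x,
    A n `<=` \bigcup_(c in C) F c &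
    forall s, F x s -> 0 < visit_prob k n (fun i => A i.+1) s].
Proof.
move=> mF EF; elim=> {x} [x Cx|x y xy _ [n [A [mA A0 An Apos]]]].
  exists 0%N, (fun=> F x); split => //.
  by move=> s Fs; exists x.
exists n.+1, (fun i => if i is j.+1 then A j else F x); split => //.
  by case.
move=> s Fs /=; rewrite A0; apply: integral_gt0 => //.
- by apply: measurable_funTS; apply: measurable_visit_prob.
- exact: EF xy _ Fs.
Qed.

(** The cylinder along a path to [C] has positive probability and lies inside the event of meeting
    the target. *)
Lemma avoid_set_not_reaches (T : Type) (E : T -> T -> Prop) (F : T -> set S)
    (C : set T) x :
  (forall x, measurable (F x)) ->
  (forall x y, E x y -> forall s, F x s -> 0 < k s (F y)) ->
  measurable (\bigcup_(c in C) F c) -> reaches E C x ->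
  F x `<=` ~` avoid_set k (\bigcup_(c in C) F c).
Proof.
move=> mF EF mC /(reaches_cylinder mF EF)[n [A [mA A0 An Apos]]] s Fs.
rewrite /avoid_set /= => P0.
have := Apos _ Fs; rewrite -(path_law_dirac n mA) ?A0// ltNge => /negP; apply.
rewrite -P0; apply: le_measure; rewrite ?inE.
- rewrite (_ : [set w | _] = \bigcap_(i in [set i | (i <= n)%N])
    [set w : path_space S | A i (w i)])//.
  apply: bigcap_measurable => [|i _]; first by exists 0%N.
  exact: measurable_coord_preimage.
- exact: measurable_eventually_in.
- by move=> w /(_ n (leqnn n)) /An; exists n.
Qed.

(** Fairness is applied with [A] as the set [B']: conditional probability one says that the
    intersection has the same measure as [infinitely_often_in A]. *)
Lemma fair_infinitely_often (mu : probability S R) (A B : set S) :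
  measurable A -> measurable B -> fair k mu B ->
  (forall s, A s -> 0 < k s B) ->
  path_law k mu (infinitely_often_in A `\` infinitely_often_in B) = 0.
Proof.
move=> mA mB fairB AB.
have mIA := measurable_infinitely_often_in mA.
have mIB := measurable_infinitely_often_in mB.
set P := path_law k mu.
have finP X : measurable X -> P X \is a fin_num by exact: fin_num_measure.
(* Fairness says nothing when this probability is zero, but then the claim is immediate. *)
have [PA0|PA0] := eqVneq (P (infinitely_often_in A)) 0.
  exact: subset_measure0 (measurableD mIA mIB) mIA (@subDsetl _ _ _) PA0.
have {}PA0 : 0 < P (infinitely_often_in A) by rewrite lt0e PA0 measure_ge0.
have step_gt0 (mu' : probability S R) : mu' A = 1 ->
    0 < path_law k mu' [set w | A (w 0%N) /\ B (w 1%N)].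
  move=> mu'A; rewrite path_law_two_steps//; apply: integral_gt0 => //.
    by apply: measurable_funTS; exact: measurable_kernel.
  by rewrite [X in 0 < X]mu'A.
have PE : P (infinitely_often_in B `&` infinitely_often_in A) =
    P (infinitely_often_in A).
  have := fairB A mA step_gt0 PA0; rewrite /cond_prob -/P.
  move: PA0; rewrite -(fineK (finP _ mIA)) -(fineK (finP _ (measurableI _ _ mIB mIA))).
  rewrite lte_fin inver => p0; rewrite gt_eqF// -EFinM => -[].
  by move=> /divr1_eq ->.
rewrite measureD//; last by rewrite ltey_eq finP.
by rewrite setIC [X in _ - X]PE subee// finP.
Qed.

(** Induction along the path: the bad paths recurrent in [F x] either recur in [F y], null by
    induction, or do not, null by fairness along the edge. *)
Lemma reaches_infinitely_often (mu : probability S R) (T : Type)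
    (E : T -> T -> Prop) (F : T -> set S) (C : set T) x :
  (forall x, measurable (F x)) -> (forall x, fair k mu (F x)) ->
  (forall x y, E x y -> forall s, F x s -> 0 < k s (F y)) ->
  measurable (\bigcup_(c in C) F c) -> reaches E C x ->
  path_law k mu (infinitely_often_in (F x) `\`
    eventually_in (\bigcup_(c in C) F c)) = 0.
Proof.
move=> mF fF EF mC.
have mD y : measurable (infinitely_often_in (F y) `\`
    eventually_in (\bigcup_(c in C) F c)).
  apply: measurableD; first exact: measurable_infinitely_often_in.
  exact: measurable_eventually_in.
elim=> {x} [x Cx|x y xy _ IH].
  rewrite (_ : _ `\` _ = set0) ?measure0//.
  apply/seteqP; split => // w [infx]; apply.
  have [i Fi] := infinite_setN0 infx; exists i; by exists x.
apply/eqP; rewrite eq_le measure_ge0 andbT.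
have mxy : measurable (infinitely_often_in (F x) `\` infinitely_often_in (F y)).
  by apply: measurableD; exact: measurable_infinitely_often_in.
rewrite -[leRHS]adde0 -[X in _ <= X + _]IH.
rewrite -(fair_infinitely_often (mF x) (mF y) (fF y) (EF _ _ xy)).
apply: le_trans (measureU2 _ (mD y) mxy).
apply: le_measure; rewrite ?inE//; first exact: measurableU.
by move=> w [infx nC]; have [infy|ninfy] := pselect (infinitely_often_in (F y) w);
  [left|right].
Qed.

End chain.

(** * Transfer of null sets through the abstraction *)

Section finite_abstraction.
Context (R : realType) d1 d2 (S1 : measurableType d1) (S2 : measurableType d2).
Variables (k1 : R.-pker S1 ~> S1) (k2 : R.-pker S2 ~> S2).
Variable alpha : {mfun S1 >-> S2}.

Lemma is_abstraction_null s (A : set S2) : is_abstraction alpha k1 k2 ->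
  measurable A -> k1 s (alpha @^-1` A) = 0 <-> k2 (alpha s) A = 0.
Proof.
move=> abs mA.
have m1 : measurable (alpha @^-1` A).
  by rewrite -[X in measurable X]setTI; exact: measurable_funP.
have := abs (dirac s) A mA.
rewrite /pushforward /one_step integral_dirac//; last exact: measurable_kernel.
rewrite ge0_integral_distribution//; last exact: measurable_kernel.
rewrite integral_dirac//=; last first.
  apply: (measurableT_comp (measurable_kernel k2 A mA)).
  exact: measurable_funP.
by rewrite !diracT !mul1e.
Qed.

End finite_abstraction.

Theorem proposition37 (R : realType) (d1 d2 : measure_display)
    (S1 : measurableType d1) (S2 : measurableType d2)
    (k1 : R.-pker S1 ~> S1) (k2 : R.-pker S2 ~> S2)
    (alpha : {mfun S1 >-> S2}) (mu : probability S1 R) :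
  finite_set [set: S2] ->
  (forall A : set S2, measurable A) ->
  is_abstraction alpha k1 k2 ->
  (forall B : set S1, measurable B -> alpha_closed alpha B -> fair k1 mu B) ->
  forall B : set S1, measurable B -> alpha_closed alpha B -> decisive k1 mu B.
Proof.
move=> finS2 mS2 abs fairk B mB closedB.
have finA (A : set S2) : finite_set A by exact: sub_finite_set finS2.
have mpre (A : set S2) : measurable (alpha @^-1` A).
  by rewrite -[X in measurable X]setTI; apply: measurable_funP.
pose E x y := 0 < k2 x [set y].
pose F x := alpha @^-1` [set x].
pose C := alpha @` B.
have mF x : measurable (F x) by exact: mpre.
have EF x y : E x y -> forall s, F x s -> 0 < k1 s (F y).
  move=> + s Fs; rewrite /E -(Fs : alpha s = x) !lt0e !measure_ge0 !andbT.
  by move=> /eqP k2y; apply/eqP => /(is_abstraction_null s abs (mS2 [set y])).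
have CE : B = \bigcup_(c in C) F c.
  rewrite [LHS]closedB; apply/seteqP; split => [s Cs|s [c Cc Fs]].
    by exists (alpha s).
  by rewrite /preimage /= (Fs : alpha s = c).
pose N := alpha @^-1` (~` reaches E C).
have NE : avoid_set k1 B = N.
  apply/seteqP; split => [s sB sN|].
    by move: sB; rewrite CE; apply: (avoid_set_not_reaches mF EF _ sN) => //;
      rewrite -CE.
  apply: absorbing_sub_avoid_set => //; first exact: mpre.
    (* [N] is absorbing: each of the finitely many [y] reaching [C] has mass zero under
       [k2 (alpha s)], since an edge to [y] would make [alpha s] reach [C]. *)
    move=> s Ns; rewrite /N preimage_setC setCK.
    apply/(is_abstraction_null _ abs (mS2 _)).
    rewrite (_ : reaches E C = \bigcup_(y in reaches E C) [set y]); last first.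
      by apply/seteqP; split=> [y Cy|y [z Cz ->//]]; exists y.
    apply: measure_bigcup_finite0 => // y Cy.
    apply/eqP; rewrite -measure_le0 leNgt; apply/negP => sy.
    by apply: Ns; exact: reaches_step sy Cy.
  move=> s Bs; apply; apply: reaches_here.
  by exists s.
have fF x : fair k1 mu (F x).
  apply: fairk => //; apply/seteqP; split => [s Fs|s [t Ft ts]].
    by exists s.
  by rewrite /F /preimage /= -ts.
rewrite /decisive NE.
have mD : measurable (eventually_in B `|` eventually_in N).
  by apply: measurableU; apply: measurable_eventually_in => //; exact: mpre.
have mG x : measurable (infinitely_often_in (F x) `\` eventually_in B).
  apply: measurableD; first exact: measurable_infinitely_often_in.
  exact: measurable_eventually_in.
have null : path_law k1 mu (\bigcup_(x in reaches E C)
    (infinitely_often_in (F x) `\` eventually_in B)) = 0.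
  apply: measure_bigcup_finite0 => // x xC; rewrite CE.
  by apply: (reaches_infinitely_often mF fF EF _ xC); rewrite -CE.
(* It remains to cover the complementary event by the null set of [null]. *)
rewrite -[X in path_law _ _ X]setCK probability_setC; last exact: measurableC.
rewrite (subset_measure0 (measurableC mD) _ _ null) ?sube0//.
  by apply: fin_bigcup_measurable => // x _; exact: finA.
move=> w /= /not_orP[nB nN].
have [x infx] : exists x, infinitely_often_in (F x) w.
  apply: contrapT => /forallNP fin; apply: infinite_nat.
  (* Otherwise the set of all times would be a finite union of finite sets of visit times. *)
  rewrite (_ : setT = \bigcup_(x in [set: S2]) [set i | F x (w i)]).
    by apply: bigcup_finite => // x _; apply: contrapT; exact: fin.
  by apply/seteqP; split => // i _; exists (alpha (w i)).
(* If the recurrent [x] did not reach [C], any visit to its fibre would be a visit to [N]. *)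
exists x => //; apply: contrapT => nx.
have [i Fi] := infinite_setN0 infx.
by apply: nN; exists i; rewrite /N /preimage /= (Fi : alpha (w i) = x).
Qed.
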